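(* Let $D$ be an infinite division ring contained as a subring of a ring $R$. Then for every $n>1$, the ring $\mathbb{M}_n(R)$ has infinitely many maximal left ideals and infinitely many maximal right ideals. Equivalently, for an infinite division ring $D$ and $n>1$, any ring $T$ that contains $\mathbb{M}_n(D)$ as a subring has infinitely many maximal left ideals and infinitely many maximal right ideals.
   Context: Rings are unital with $1\neq 0$ and subrings are unital (share the same identity). $\mathbb{M}_n(R)$ is the ring of $n\times n$ matrices over $R$. *)

(* Defs.v *)
From mathcomp Require Export all_boot all_algebra.
From mathcomp Require Export boolp classical_sets cardinality.

Set Implicit Arguments.
Unset Strict Implicit.
Unset Printing Implicit Defensive.

Import GRing.Theory.
Local Open Scope classical_set_scope.
Local Open Scope ring_scope.

(* [GRing.field_axiom] does not include commutativity of the product, and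
   units of a [unitRingType] are two-sided units. *)
Definition division_ring (D : unitRingType) : Prop := GRing.field_axiom D.

(* [pzRingType] rather than [nzRingType]: square matrices of variable size n
   form canonically only a [pzRingType]. Closure under opposites follows from
   closure under multiplication by -1. *)
Definition left_ideal (T : pzRingType) (I : set T) : Prop :=
  [/\ I 0,
      forall x y, I x -> I y -> I (x + y)
    & forall a x, I x -> I (a * x)].

Definition right_ideal (T : pzRingType) (I : set T) : Prop :=
  [/\ I 0,
      forall x y, I x -> I y -> I (x + y)
    & forall a x, I x -> I (x * a)].

Definition maximal_left_ideal (T : pzRingType) (I : set T) : Prop :=
  [/\ left_ideal I,
      I <> setT
    & forall J : set T, left_ideal J -> J <> setT -> I `<=` J -> J = I].

Definition maximal_right_ideal (T : pzRingType) (I : set T) : Prop :=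
  [/\ right_ideal I,
      I <> setT
    & forall J : set T, right_ideal J -> J <> setT -> I `<=` J -> J = I].

(* Main.v *)
Require Import Defs.

Import GRing.Theory.
Local Open Scope classical_set_scope.
Local Open Scope ring_scope.

(** Infinitely many elements [x_a], none left invertible but any two of them
generating the unit left ideal, lie in pairwise distinct maximal left ideals.
If [v * v = 0] and [v * u * v = v <> 0], then for suitable scalars [s a] the
elements [(u + s a) * v] are nonzero idempotents, and [x_a = 1 - (u + s a) * v]
is such a family.  In matrix rings, take [v] and [u] to be two transposed
off-diagonal matrix units and [s a] scalar matrices; exchanging [u] and [v]
gives the same configuration in the opposite ring, hence the result for right
ideals. *)

Lemma left_ideal_neqT {T : pzRingType} {I : set T} :
  left_ideal I -> I <> setT <-> ~ I 1.
Proof.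
move=> [_ _ IM]; split=> [IT I1|I1 IT]; last by apply: I1; rewrite IT.
apply: IT; rewrite -subTset => x _; rewrite -(mulr1 x); exact: IM.
Qed.

(** Being proper amounts to missing 1, a condition that passes to unions of chains, so Zorn's lemma
    applies. *)
Lemma maximal_left_ideal_exists (T : pzRingType) (I : set T) :
  left_ideal I -> ~ I 1 -> exists2 M, maximal_left_ideal M & I `<=` M.
Proof.
move=> idI I1.
(* Joining [I] to the members of a chain also covers the empty chain. *)
pose P (J : set T) := left_ideal (I `|` J) /\ ~ (I `|` J) 1.
have [F FP Ftot|A [[idA A1] Amax]] := @Zorn_bigcup T P.
  have [I0 ID IM] := idI.
  split; last by case=> // -[X /FP[_ +] X1]; apply; right.
  split; first by left.
  - move=> x y [Ix|[X FX Xx]] [Iy|[Y FY Yy]].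
    + by left; apply: ID.
    + have [[_ YD _] _] := FP _ FY.
      by case: (YD x y (or_introl Ix) (or_intror Yy)) => ?; [left|right; exists Y].
    + have [[_ XD _] _] := FP _ FX.
      by case: (XD x y (or_intror Xx) (or_introl Iy)) => ?; [left|right; exists X].
    + have [Z FZ [Zx Zy]] : exists2 Z, F Z & Z x /\ Z y.
        case: (Ftot X Y FX FY) => [XY|YX]; [exists Y|exists X] => //.
          by split=> //; apply: XY.
        by split=> //; apply: YX.
      have [[_ ZD _] _] := FP _ FZ.
      by case: (ZD x y (or_intror Zx) (or_intror Zy)) => ?; [left|right; exists Z].
  - move=> a x [Ix|[X FX Xx]]; first by left; apply: IM.
    have [[_ _ XM] _] := FP _ FX.
    by case: (XM a x (or_intror Xx)) => ?; [left|right; exists X].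
exists (I `|` A); last by left.
split=> //; first exact/(left_ideal_neqT idA).
move=> J idJ /(left_ideal_neqT idJ) J1 IAJ.
have IJ : I `|` J = J by apply/setUidPr => x Ix; apply: IAJ; left.
apply: contrapT => JNIA; apply: (Amax J); last by rewrite /P IJ.
split=> [x Ax|JA]; first by apply: IAJ; right.
by apply: JNIA; apply/seteqP; split=> // x /JA; right.
Qed.

Lemma infinite_maximal_left_ideals_comaximal
    (A : Type) (T : pzRingType) (x : A -> T) :
  infinite_set [set: A] ->
  (forall a, exists2 p, p <> 0 & x a * p = 0) ->
  (forall a b, a <> b -> exists c d, c * x a + d * x b = 1) ->
  infinite_set [set I : set T | maximal_left_ideal I].
Proof.
move=> infA annx comx.
have /choice[M Mx] a : exists M : set T, maximal_left_ideal M /\ M (x a).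
  have [p p0 xp] := annx a.
  (* The left annihilator of [p] contains [x a] and misses 1 because [p] is nonzero. *)
  have [||M maxM xM] := @maximal_left_ideal_exists T [set y | y * p = 0].
  - split=> [|y z /= yp zp|b y /= yp]; first exact: mul0r.
      by rewrite mulrDl yp zp addr0.
    by rewrite -mulrA yp mulr0.
  - by rewrite /= mul1r.
  by exists M; split=> //; apply: xM.
move=> finM; apply: infA.
rewrite -[setT](_ : M @^-1` [set I | maximal_left_ideal I] = _); last first.
  by apply/seteqP; split=> // a _; have [] := Mx a.
(* The choice [M] is injective: if [M a = M b] with [a <> b], this ideal contains both [x a] and
   [x b], hence 1. *)
apply: finite_preimage finM => a b _ _ Mab; apply: contrapT => ab.
have [[idM properM _] Ma] := Mx a.
have Mb : M a (x b) by rewrite Mab; have [] := Mx b.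
have [c [d cd1]] := comx a b ab.
apply: (left_ideal_neqT idM).1 => //; rewrite -cd1.
by have [_ MD MM] := idM; apply: MD; apply: MM.
Qed.

Lemma infinite_maximal_left_ideals_square_zero
    (A : Type) (T : pzRingType) (s : A -> T) (u v : T) :
  infinite_set [set: A] ->
  v <> 0 -> v * v = 0 -> v * u * v = v ->
  (forall a, v * s a * v = 0) ->
  (forall a b, a <> b -> exists w, w * (s a - s b) = 1) ->
  infinite_set [set I : set T | maximal_left_ideal I].
Proof.
move=> infA v0 vv vuv vsv sunit.
apply: (@infinite_maximal_left_ideals_comaximal A T
  (fun a => 1 - (u + s a) * v)) => // [a|a b ab].
  (* With [p = (u + s a) * v], this reads [v * p = v]. It makes [p] nonzero and idempotent, so
     [1 - p] kills [p]. *)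
  have vp : v * ((u + s a) * v) = v by rewrite mulrA mulrDr mulrDl vuv vsv addr0.
  exists ((u + s a) * v); first by move=> p0; apply: v0; rewrite -vp p0 mulr0.
  by rewrite mulrBl mul1r -[_ * v * _]mulrA vp subrr.
have [w wab] := sunit a b ab.
(* Writing [x a] for [1 - (u + s a) * v], one has [x b - x a = (s a - s b) * v]. Multiplying by [w]
   on the left leaves [v], so [t * (x b - x a) = 1 - x a]. *)
pose t := (u + s a) * w; exists (1 - t), t.
have xBx : 1 - (u + s b) * v - (1 - (u + s a) * v) = (s a - s b) * v.
  by rewrite opprB addrC addrA addrNK -mulrBl opprD addrACA subrr add0r.
rewrite mulrBl mul1r -addrA [- _ + _]addrC -mulrBr xBx /t -mulrA (mulrA w) wab.
by rewrite mul1r addrNK.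
Qed.

(** Taking [T] in [pzRingType] lets ['M[R]_n] with variable [n] be an instance. *)
Lemma infinite_maximal_ideals_matrix_subring
    (D : unitRingType) (n : nat) (T : pzRingType) (g : {rmorphism 'M[D]_n -> T}) :
  division_ring D -> infinite_set [set: D] -> (1 < n)%N -> injective g ->
  infinite_set [set I : set T | maximal_left_ideal I] /\
  infinite_set [set I : set T | maximal_right_ideal I].
Proof.
move=> divD infD n1 injg.
pose i := Ordinal (ltnW n1); pose j := Ordinal n1.
pose e (k l : 'I_n) : 'M[D]_n := delta_mx k l.
have eM k l m : e k l * e l m = e k m by apply: mul_delta_mx.
have e0 k l : k != l -> e k l * e k l = 0.
  by move=> kl; apply: mul_delta_mx_0; rewrite eq_sym.
have gn0 k l : g (e k l) <> 0.
  rewrite -(rmorph0 g) => /injg /matrixP /(_ k l).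
  by rewrite !mxE !eqxx; apply/eqP/oner_neq0.
have geM k l : g (e k l) * g (e l k) * g (e k l) = g (e k l).
  by rewrite -!rmorphM /= !eM.
have geMM k l : k != l -> g (e k l) * g (e k l) = 0.
  by move=> kl; rewrite -rmorphM /= e0 // rmorph0.
have ges k l (a : D) : k != l -> g (e k l) * g a%:M * g (e k l) = 0.
  move=> kl; rewrite -!rmorphM /= -[RHS](rmorph0 g); congr (g _).
  (* Even over a noncommutative [D] this holds, since the entries of [e k l] are 0 and 1. *)
  suff -> : e k l * a%:M = a%:M * e k l by rewrite -mulrA e0 // mulr0.
  rewrite -!mulmxE mul_scalar_mx -diag_const_mx mul_mx_diag; apply/matrixP => ? ?.
  by rewrite !mxE; case: (_ && _); rewrite ?mulr1 ?mul1r ?mulr0 ?mul0r.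
have inv_subr (a b : D) : a <> b -> a - b \is a GRing.unit.
  by move=> /eqP ab; apply: divD; rewrite subr_eq0.
split.
  apply: (@infinite_maximal_left_ideals_square_zero D T
    (fun a => g a%:M) (g (e i j)) (g (e j i))) => //; [exact: geMM | | ].
    by move=> a; apply: ges.
  move=> a b /inv_subr uab; exists (g ((a - b)^-1)%:M).
  by rewrite -rmorphB -rmorphM /= -raddfB /= -mulmxE -scalar_mxM mulVr // rmorph1.
(* Left ideals of [T^c] are right ideals of [T]. The relations on [u], [v] and [s a] are
   palindromic, so the same elements serve; a left inverse in [T^c] is a right inverse in [T]. *)
apply: (@infinite_maximal_left_ideals_square_zero D T^c
  (fun a => g a%:M) (g (e i j)) (g (e j i))) => //.
- exact: geMM.
- by rewrite -mulrA; apply: geM.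
- by move=> a; rewrite -mulrA; apply: ges.
move=> a b /inv_subr uab; exists (g ((a - b)^-1)%:M).
suff : g (a%:M - b%:M) * g ((a - b)^-1)%:M = 1 by rewrite rmorphB.
by rewrite -rmorphM /= -raddfB /= -mulmxE -scalar_mxM mulrV // rmorph1.
Qed.

Theorem corollary3p28 :
  (forall (D : unitRingType) (R : nzRingType) (f : {rmorphism D -> R}),
     division_ring D -> infinite_set [set: D] -> injective f ->
     forall n : nat, (1 < n)%N ->
       infinite_set [set I : set 'M[R]_n | maximal_left_ideal I] /\
       infinite_set [set I : set 'M[R]_n | maximal_right_ideal I])
  /\
  (forall (D : unitRingType) (n : nat) (T : nzRingType)
          (g : {rmorphism 'M[D]_n -> T}),
     division_ring D -> infinite_set [set: D] -> (1 < n)%N -> injective g ->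
       infinite_set [set I : set T | maximal_left_ideal I] /\
       infinite_set [set I : set T | maximal_right_ideal I]).
Proof.
split=> [D R f divD infD injf n n1|D n T g]; last first.
  exact: infinite_maximal_ideals_matrix_subring.
(* Applying [f] entrywise embeds ['M[D]_n] into ['M[R]_n]. *)
apply: (@infinite_maximal_ideals_matrix_subring D n _ (map_mx f)) => //.
move=> A B /matrixP AB; apply/matrixP => i j; apply: injf.
by have := AB i j; rewrite !mxE.
Qed.
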